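(* Let $k,l\ge 1$ be integers, $n=k+l$, let $J=\mathrm{diag}(J_1,\dots,J_n)$ be a real diagonal matrix with all $J_i\neq 0$, and let $\kappa>0$. Let $\Phi$ be the Heisenberg map on the light-like cone (the case $c=0$), and let $P_0^*$, $\alpha$, $\mathbf L$, $M_\kappa=M_{\kappa,+}\cup M_{\kappa,-}$ be as defined in the context. Then the restriction of the 1-form $\alpha=\sum_i\tau_iJ_iQ_i\,dq_i$ to the $(2n-3)$-dimensional manifold $M_\kappa$ is a contact form. Moreover, $\Phi$ (where defined) restricts to a contact transformation of $M_\kappa$, namely $$\Phi^*\alpha=\alpha \quad\text{on } M_\kappa ,$$ and $\Phi$ interchanges the parts $M_{\kappa,+}$ and $M_{\kappa,-}$ of $M_\kappa$ (it maps points of $M_{\kappa,\pm}$ in its domain to $M_{\kappa,\mp}$).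
   Context: Pseudo-Euclidean space: $E^{k,l}$ is $\mathbb R^n$ with scalar product $\langle x,y\rangle=\sum_{i=1}^n\tau_ix_iy_i$, where $\tau_1=\dots=\tau_k=1$, $\tau_{k+1}=\dots=\tau_n=-1$. Light-like cone and phase space ($c=0$): $S_0^{n-1}=\{q\in\mathbb R^n: \langle q,q\rangle=0\}$, $P_0=S_0^{n-1}\times S_0^{n-1}$ with points $(q,Q)$, and $P_0^*=\{(q,Q)\in P_0:\langle q,J^{-1}Q\rangle\neq 0\}$, a smooth manifold of dimension $2n-2$. Heisenberg map: for $(q,Q)\in P_0$ with $\langle J^{-2}Q,Q\rangle\ne 0$, $$\Phi(q,Q)=\bigl(Q,\ \lambda J^{-1}Q-q\bigr),\qquad \lambda=\frac{2\langle J^{-1}Q,q\rangle}{\langle J^{-2}Q,Q\rangle}.$$ $\Phi$ is only defined outside the singular set $\{\langle J^{-2}Q,Q\rangle=0\}$; where defined, it maps into $P_0$ and preserves $P_0^*$. All statements about $\Phi$ are understood on its domain of definition. Discrete Lagrangian: $\mathbf L(q,Q)=\langle q,JQ\rangle=\sum_i\tau_iJ_iq_iQ_i$. Level sets: $M_{\kappa,\pm}=\{(q,Q)\in P_0^*:\mathbf L(q,Q)=\pm\kappa\}$ and $M_\kappa=M_{\kappa,+}\cup M_{\kappa,-}$. A 1-form $\alpha$ on a $(2m+1)$-dimensional manifold is a contact form if it vanishes nowhere and the restriction of $d\alpha$ to $\ker\alpha$ is nondegenerate at every point. *)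

(* Defs.v *)
From HB Require Import structures.
From mathcomp Require Import all_boot all_order all_algebra.
From mathcomp Require Import all_classical all_reals all_analysis.

Set Implicit Arguments.
Unset Strict Implicit.
Unset Printing Implicit Defensive.

Import Order.TTheory GRing.Theory Num.Theory.
Import numFieldNormedType.Exports.

Local Open Scope classical_set_scope.
Local Open Scope ring_scope.

(* [Ck U j f] is meant for U open: it then only depends on f restricted to U,
   since 'D_v f x only depends on the germ of f at x. *)
Fixpoint Ck (R : realType) (V W : normedModType R) (U : set V)
    (j : nat) (f : V -> W) : Prop :=
  match j with
  | 0%N => forall x, U x -> {for x, continuous f}
  | j'.+1 => (forall x, U x -> differentiable f x) /\
             (forall v, Ck U j' ('D_v f))
  end.

Definition smooth_on (R : realType) (V W : normedModType R) (U : set V)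
    (f : V -> W) : Prop :=
  forall j, Ck U j f.

Definition tangent_space (R : realType) (V : normedModType R) (M : set V)
    (p : V) : set V :=
  [set v | exists e : R, 0 < e /\ exists gamma : R -> V,
    [/\ smooth_on [set` `]- e, e[] gamma,
        forall t, t \in `]- e, e[ -> M (gamma t),
        gamma 0 = p &
        'D_1 gamma 0 = v]].

Definition phase_space (R : realType) (n : nat) : normedModType R :=
  ('rV[R]_n * 'rV[R]_n)%type.

(* Embedded submanifolds of R^n x R^n of dimension d (codimension c): locally,
   preimages of the regular value 0 of smooth maps to R^c. *)
Definition submanifold (R : realType) (n d : nat) (M : set (phase_space R n)) :
    Prop :=
  exists c : nat, (c + d = n + n)%N /\
  forall p, M p -> exists (U : set (phase_space R n))
                          (g : phase_space R n -> 'rV[R]_c),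
    [/\ open U, U p, smooth_on U g,
        (forall x, U x -> (M x <-> g x = 0)) &
        (forall x, U x -> g x = 0 -> forall y, exists w, 'd g x w = y)].

(* 1-forms on a submanifold are given by 1-forms on the ambient space,
   restricted to the tangent spaces. *)
Definition one_form (R : realType) (V : normedModType R)
    (alpha : V -> V -> R) : Prop :=
  (forall p, scalar (alpha p)) /\
  (forall v, smooth_on setT (fun p => alpha p v)).

(* d alpha (u, v) = u(alpha(v)) - v(alpha(u)) - alpha([u, v]), evaluated on
   constant vector fields u, v, for which [u, v] = 0. Since d commutes with
   pullbacks, its restriction to the tangent spaces of a submanifold is the
   exterior derivative of the restriction of alpha. *)
Definition ext_deriv (R : realType) (V : normedModType R)
    (alpha : V -> V -> R) (p u v : V) : R :=
  'D_u (fun x => alpha x v) p - 'D_v (fun x => alpha x u) p.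

Definition contact_form (R : realType) (n d : nat) (M : set (phase_space R n))
    (alpha : phase_space R n -> phase_space R n -> R) : Prop :=
  [/\ submanifold d M, odd d, one_form alpha,
      (forall p, M p -> exists2 u, tangent_space M p u & alpha p u != 0) &
      (forall p, M p -> forall u, tangent_space M p u -> alpha p u = 0 ->
        (forall v, tangent_space M p v -> alpha p v = 0 ->
           ext_deriv alpha p u v = 0) ->
        u = 0)].

Definition pullback (R : realType) (V : normedModType R) (F : V -> V)
    (alpha : V -> V -> R) (p u : V) : R :=
  alpha (F p) ('d F p u).

(* F, defined on the open set U, restricts to a diffeomorphism between the
   (relatively) open subset U of M and a (relatively) open subset U' of M. *)
Definition partial_diffeo (R : realType) (V : normedModType R) (M U : set V)
    (F : V -> V) : Prop :=
  [/\ open U, smooth_on U F &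
      exists (U' : set V) (G : V -> V),
      [/\ open U', smooth_on U' G,
          (forall p, M p -> U p -> [/\ M (F p), U' (F p) & G (F p) = p]) &
          (forall p, M p -> U' p -> [/\ M (G p), U (G p) & F (G p) = p])]].

Definition tau (R : realType) (k l : nat) (i : 'I_(k + l)) : R :=
  if (i < k)%N then 1 else -1.

Definition ip (R : realType) (k l : nat) (x y : 'rV[R]_(k + l)) : R :=
  \sum_i tau R i * x 0 i * y 0 i.

(* The matrix J is diagonal, hence symmetric, so that it may act on row vectors
   from the right; J : 'rV_n is its diagonal. *)
Definition actJ (R : realType) (n : nat) (J q : 'rV[R]_n) : 'rV[R]_n :=
  q *m diag_mx J.

Definition actJinv (R : realType) (n : nat) (J q : 'rV[R]_n) : 'rV[R]_n :=
  q *m invmx (diag_mx J).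

Definition light_cone (R : realType) (k l : nat) : set 'rV[R]_(k + l) :=
  [set q | ip q q = 0].

Definition P0 (R : realType) (k l : nat) : set (phase_space R (k + l)) :=
  [set p | @light_cone R k l p.1 /\ @light_cone R k l p.2].

Definition P0star (R : realType) (k l : nat) (J : 'rV[R]_(k + l)) :
    set (phase_space R (k + l)) :=
  [set p | @P0 R k l p /\ ip p.1 (actJinv J p.2) != 0].

Definition heis_domain (R : realType) (k l : nat) (J : 'rV[R]_(k + l)) :
    set (phase_space R (k + l)) :=
  [set p | ip (actJinv J (actJinv J p.2)) p.2 != 0].

Definition heis_lambda (R : realType) (k l : nat) (J : 'rV[R]_(k + l))
    (p : phase_space R (k + l)) : R :=
  2 * ip (actJinv J p.2) p.1 / ip (actJinv J (actJinv J p.2)) p.2.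

Definition heisenberg (R : realType) (k l : nat) (J : 'rV[R]_(k + l))
    (p : phase_space R (k + l)) : phase_space R (k + l) :=
  (p.2, heis_lambda J p *: actJinv J p.2 - p.1).

Definition lagrangian (R : realType) (k l : nat) (J : 'rV[R]_(k + l))
    (p : phase_space R (k + l)) : R :=
  ip p.1 (actJ J p.2).

Definition M_plus (R : realType) (k l : nat) (J : 'rV[R]_(k + l)) (kappa : R) :
    set (phase_space R (k + l)) :=
  [set p | P0star J p /\ lagrangian J p = kappa].

Definition M_minus (R : realType) (k l : nat) (J : 'rV[R]_(k + l)) (kappa : R) :
    set (phase_space R (k + l)) :=
  [set p | P0star J p /\ lagrangian J p = - kappa].

Definition M_level (R : realType) (k l : nat) (J : 'rV[R]_(k + l)) (kappa : R) :
    set (phase_space R (k + l)) :=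
  M_plus J kappa `|` M_minus J kappa.

(* alpha = sum_i tau_i J_i Q_i dq_i at p = (q, Q), on u = (dq, dQ) *)
Definition alpha_form (R : realType) (k l : nat) (J : 'rV[R]_(k + l))
    (p u : phase_space R (k + l)) : R :=
  \sum_i tau R i * J 0 i * p.2 0 i * u.1 0 i.

(* Main.v *)
(* Let L = <q, J Q>, so that alpha = <J Q, dq>. On M, the functions <q, q>,
   <Q, Q> and L are independent: their differentials are dual, up to nonzero
   factors, to (J^-1 Q, 0), (0, J^-1 q) and (q, 0). The flow of the hyperbolic
   scaling (q, Q) -> (s q, Q / s) preserves M, and alpha evaluates to L <> 0 on
   its velocity. The kernel of alpha on the tangent space is the sum of
   (span (q, J Q))^perp in the q-direction and (span (Q, J q))^perp in the
   Q-direction, and d alpha pairs these two spaces by (a, b) -> <a, J b>, which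
   is nondegenerate because L and <q, J^-1 Q> do not vanish. Finally
   Phi^* alpha = <lambda Q - J q, dQ> = - <J q, dQ>, which is alpha because
   dL = 0 on M. *)
Require Import Defs.
From HB Require Import structures.
From mathcomp Require Import all_boot all_order all_algebra.
From mathcomp Require Import all_classical all_reals all_analysis.
From mathcomp Require Import zify ring.

Set Implicit Arguments.
Unset Strict Implicit.
Unset Printing Implicit Defensive.

Import Order.TTheory GRing.Theory Num.Theory.
Import numFieldNormedType.Exports.

Local Open Scope classical_set_scope.
Local Open Scope ring_scope.

(** * Closure properties of the classes [Ck] and rules for directional derivatives *)

Section Calculus.
Context {R : realType}.
Implicit Types V W : normedModType R.

(** The affine approximation of [f] at [x] also approximates [g], because the error term only
    involves values near [x]; uniqueness of the differential then identifies ['d g x] with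
    ['d f x]. *)
Lemma near_eq_differentiable V W (f g : V -> W) (x : V) :
  (\near x, f x = g x) -> differentiable f x -> differentiable g x.
Proof.
move=> fg df; have fgx : f x = g x := nbhs_singleton fg.
suff gE : g \o shift x = cst (g x) + 'd f x +o_ 0 id.
  have dg := diff_unique (diff_continuous df) gE.
  by apply/diff_locallyP; split; rewrite dg //; exact: diff_continuous.
apply/eqaddoP => e e0.
have /eqaddoP/(_ e e0) fo := diff_locally df.
have fg0 : \forall h \near (0 : V), f (h + x) = g (h + x).
  by move: fg; rewrite (near_shift 0) subr0.
near=> h.
have : `|(f \o shift x - (cst (f x) + 'd f x)) h| <= e * `|id h| by near: h.
rewrite !fctE /= fgx.
by have -> : f (h + x) = g (h + x) by near: h.
Unshelve. all: by end_near. Qed.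

Lemma Ck_differentiable V W (U : set V) (f : V -> W) x :
  Ck U 1 f -> U x -> differentiable f x.
Proof. by move=> [df _] /df. Qed.

(** On an open set, equality holds near each point, so it passes to all directional derivatives. The
    closure proofs below use it to replace a derivative by its formula, which is known on [U]
    only. *)
Lemma Ck_eq V W (U : set V) (j : nat) (f g : V -> W) :
  open U -> (forall x, U x -> f x = g x) -> Ck U j f -> Ck U j g.
Proof.
move=> oU; elim: j f g => [|j IH] f g fg /=.
  move=> cf x Ux.
  have nfg : \near x, f x = g x by apply: filterS (open_nbhs_nbhs (conj oU Ux)).
  have gx : g @ x --> f x by apply: cvg_trans (cf x Ux); exact: near_eq_cvg.
  by rewrite (fg _ Ux) in gx.
move=> [df cf]; split=> [x Ux|v].
  apply: near_eq_differentiable (df x Ux).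
  by apply: filterS (open_nbhs_nbhs (conj oU Ux)).
apply: IH (cf v) => x Ux; apply: near_eq_derive.
by apply: filterS (open_nbhs_nbhs (conj oU Ux)).
Qed.

Lemma CkW V W (U : set V) (j : nat) (f : V -> W) : Ck U j.+1 f -> Ck U j f.
Proof.
elim: j f => [|j IH] f /= [df cf]; last by split=> // v; apply/IH/cf.
by move=> x /df/differentiable_continuous.
Qed.

Lemma Ck_sub V W (A B : set V) (j : nat) (f : V -> W) :
  A `<=` B -> Ck B j f -> Ck A j f.
Proof.
move=> AB; elim: j f => [|j IH] f /=; first by move=> cf x /AB/cf.
by move=> [df cf]; split=> [x /AB/df//|v]; apply/IH/cf.
Qed.

Lemma Ck_cst V W (U : set V) (j : nat) (a : W) : Ck U j (fun _ : V => a).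
Proof.
elim: j a => [|j IH] a /=; first by move=> x _; exact: cst_continuous.
split=> [x _|v]; first exact: differentiable_cst.
suff -> : 'D_v (fun=> a) = (fun _ : V => 0 : W) by [].
by apply/funext => x; exact: derive_cst.
Qed.

Lemma Ck_id V (U : set V) (j : nat) : Ck U j (fun x : V => x).
Proof.
case: j => [|j] /=; first by move=> x _; exact: cvg_id.
split=> [x _|v]; first exact: ex_diff.
suff -> : 'D_v (fun x : V => x) = (fun _ : V => v) by exact: Ck_cst.
by apply/funext => x; exact: derive_id.
Qed.

Lemma open_neq0 V (f : V -> R) :
  Ck setT 0 f -> open [set p | f p != 0].
Proof.
move=> cf; apply: (open_comp (f := f) (D := [set x | x != 0])) => [t _|].
  exact: cf.
exact: open_neq.
Qed.

Section Linear.
Context {V W : normedModType R} (L : V -> W).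
Hypotheses (linL : linear L) (cL : continuous L).

(** Linearity is a hypothesis on a plain function; the packed [LL] gives access to the results on
    bundled linear maps. *)
Let LM := GRing.isLinear.Build _ _ _ _ _ linL.
Let LL : {linear V -> W} := HB.pack L LM.

Lemma differentiable_linear x : differentiable L x.
Proof. exact: (@linear_differentiable _ _ _ LL). Qed.

Lemma derive_linear_comp (Z : normedModType R) (f : Z -> V) z v :
  differentiable f z -> 'D_v (fun y => L (f y)) z = L ('D_v f z).
Proof.
move=> df; have dL := differentiable_linear (f z).
rewrite !deriveE //; last exact: (differentiable_comp df dL).
by rewrite (diff_comp df dL) /= (@diff_lin _ _ _ LL).
Qed.

(** A continuous linear map commutes with every directional derivative. Coordinates, projections and
    inclusions of a product, and [actJ] are instances. *)
Lemma Ck_linear (Z : normedModType R) (U : set Z) j (f : Z -> V) :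
  open U -> Ck U j f -> Ck U j (fun y => L (f y)).
Proof.
move=> oU; elim: j f => [|j IH] f /=.
  move=> cf x Ux.
  exact: (@continuous_comp _ _ _ f L x (cf x Ux) (@cL (f x))).
move=> [df cf]; split=> [x Ux|v].
  exact: (differentiable_comp (df x Ux) (differentiable_linear _)).
apply: Ck_eq (IH _ (cf v)) => // x Ux.
by rewrite derive_linear_comp //; exact: df.
Qed.

End Linear.

Section Operations.
Context {V : normedModType R} (U : set V).
Hypothesis oU : open U.

Lemma CkD W j (f g : V -> W) :
  Ck U j f -> Ck U j g -> Ck U j (fun x => f x + g x).
Proof.
elim: j f g => [|j IH] f g /=.
  by move=> cf cg x Ux; apply: cvgD; [exact: cf|exact: cg].
move=> [df cf] [dg cg]; split=> [x Ux|v].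
  by apply: differentiableD; [exact: df|exact: dg].
apply: Ck_eq (IH _ _ (cf v) (cg v)) => // x Ux; apply/esym.
by apply: deriveD; apply: diff_derivable; [exact: df|exact: dg].
Qed.

(** In the Leibniz rule each term keeps one factor undifferentiated; [CkW] lowers its class to that
    of the induction hypothesis. *)
Lemma CkM j (f g : V -> R) :
  Ck U j f -> Ck U j g -> Ck U j (fun x => f x * g x).
Proof.
elim: j f g => [|j IH] f g.
  by move=> cf cg x Ux; apply: cvgM; [exact: cf|exact: cg].
move=> Cf Cg; have [df cf] := Cf; have [dg cg] := Cg; split=> [x Ux|v].
  by apply: differentiableM; [exact: df|exact: dg].
apply: Ck_eq (CkD (IH _ _ (CkW Cf) (cg v)) (IH _ _ (CkW Cg) (cf v))) => // x Ux.
by apply/esym; apply: deriveM; apply: diff_derivable; [exact: df|exact: dg].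
Qed.

Lemma CkV j (f : V -> R) :
  (forall x, U x -> f x != 0) -> Ck U j f -> Ck U j (fun x => (f x)^-1).
Proof.
move=> f0; elim: j f f0 => [|j IH] f f0.
  by move=> cf x Ux; apply: cvgV; [exact: f0|exact: cf].
move=> Cf; have [df cf] := Cf; split=> [x Ux|v].
  by apply: differentiableV; [exact: df|exact: f0].
have CV := IH _ f0 (CkW Cf).
(* The derivative of 1/f is - f^-2 Df, where 1/f has class j by induction. *)
have Cm := CkM (@Ck_cst V R U j (-1)) (CkM (CkM CV CV) (cf v)).
apply: (Ck_eq oU _ Cm) => x Ux.
rewrite [RHS](@deriveV _ _ f) ?f0 //; last exact/diff_derivable/df.
by rewrite mulN1r scaleNr -invfM -expr2.
Qed.

Lemma Ck_sum W j n (F : 'I_n -> V -> W) :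
  (forall i, Ck U j (F i)) -> Ck U j (fun x => \sum_i F i x).
Proof.
move=> CF; elim: (index_enum _) => [|i s IH].
  by apply: Ck_eq (Ck_cst _ _ 0) => // x _; rewrite big_nil.
by apply: Ck_eq (CkD (CF i) IH) => // x _; rewrite big_cons.
Qed.

Lemma Ck_rV j n (f : V -> 'rV[R]_n) :
  (forall i, Ck U j (fun x => f x 0 i)) -> Ck U j f.
Proof.
move=> Cf.
apply: (Ck_eq oU (f := fun x => \sum_i f x 0 i *: delta_mx 0 i)).
  by move=> x _; rewrite -row_sum_delta.
apply: Ck_sum => i.
apply: (@Ck_linear R 'rV[R]_n (fun c => c *: delta_mx 0 i)) => //.
- by move=> c u v; rewrite scalerDl scalerA.
- exact: scalel_continuous.
Qed.

Lemma Ck_coord j n (f : V -> 'rV[R]_n) i :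
  Ck U j f -> Ck U j (fun x => f x 0 i).
Proof.
apply: (@Ck_linear 'rV[R]_n R (fun y => y 0 i)) => //.
- by move=> c u v; rewrite !mxE.
- exact: coord_continuous.
Qed.

Lemma Ck_fst W W' j (f : V -> W * W') : Ck U j f -> Ck U j (fun x => (f x).1).
Proof.
by apply: (@Ck_linear (W * W')%type W fst) => // x; exact: cvg_fst.
Qed.

Lemma Ck_snd W W' j (f : V -> W * W') : Ck U j f -> Ck U j (fun x => (f x).2).
Proof.
by apply: (@Ck_linear (W * W')%type W' snd) => // x; exact: cvg_snd.
Qed.

Lemma Ck_pair W W' j (f : V -> W) (g : V -> W') :
  Ck U j f -> Ck U j g -> Ck U j (fun x => (f x, g x)).
Proof.
move=> Cf Cg.
have C1 : Ck U j (fun x => (f x, 0) : W * W').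
  apply: (@Ck_linear W (W * W')%type (fun y => (y, 0))) => //.
  - by move=> c u v; congr pair; rewrite /= scaler0 addr0.
  - by move=> x; apply: cvg_pair; [exact: cvg_id|exact: cvg_cst].
have C2 : Ck U j (fun x => (0, g x) : W * W').
  apply: (@Ck_linear W' (W * W')%type (fun y => (0, y))) => //.
  - by move=> c u v; congr pair; rewrite /= scaler0 addr0.
  - by move=> x; apply: cvg_pair; [exact: cvg_cst|exact: cvg_id].
apply: Ck_eq (CkD C1 C2) => // x _.
by congr pair; rewrite /= ?addr0 ?add0r.
Qed.

Lemma CkZ j n (k : V -> R) (f : V -> 'rV[R]_n) :
  Ck U j k -> Ck U j f -> Ck U j (fun x => k x *: f x).
Proof.
move=> Ck Cf; apply: Ck_rV => i.
by apply: Ck_eq (CkM Ck (Ck_coord i Cf)) => // x _; rewrite mxE.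
Qed.

End Operations.

Lemma derive_pair V W W' (f : V -> W) (g : V -> W') x v :
  differentiable f x -> differentiable g x ->
  'D_v (fun y => (f y, g y)) x = ('D_v f x, 'D_v g x).
Proof.
move=> df dg; rewrite !deriveE //; last exact: differentiable_pair.
by rewrite diff_pair.
Qed.

(** For t <> 0 the difference quotient at 0 is exactly [h t], so continuity of [h] at 0 suffices. *)
Lemma derive_addl_scale V (q : V) (h : R -> V) :
  {for 0, continuous h} -> 'D_1 (fun t : R => q + t *: h t) 0 = h 0.
Proof.
move=> ch; apply: cvg_lim => //.
have : h @ 0^' --> h 0.
  by apply: cvg_trans ch; apply: cvg_app; exact: cvg_within.
apply: cvg_trans; apply: near_eq_cvg; near=> t.
rewrite /= scale0r !addr0 [_ *: 1]mulr1 [q + _]addrC addrK.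
rewrite scalerA mulVf ?scale1r //.
by near: t; exact: nbhs_dnbhs_neq.
Unshelve. all: by end_near. Qed.

End Calculus.

(** * The pseudo-Euclidean scalar product *)

Section ScalarProduct.
Context {R : realType} {k l : nat}.
Implicit Types (x y z : 'rV[R]_(k + l)) (a : R).

Lemma ipC x y : ip x y = ip y x.
Proof. by apply: eq_bigr => i _; rewrite mulrAC. Qed.

Lemma ipDl x y z : ip (x + y) z = ip x z + ip y z.
Proof.
by rewrite -big_split /=; apply: eq_bigr => i _; rewrite mxE mulrDr mulrDl.
Qed.

Lemma ipZl a x y : ip (a *: x) y = a * ip x y.
Proof. by rewrite big_distrr /=; apply: eq_bigr => i _; rewrite mxE; ring. Qed.

Lemma ipDr x y z : ip x (y + z) = ip x y + ip x z.
Proof. by rewrite ipC ipDl !(ipC x). Qed.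

Lemma ipZr a x y : ip x (a *: y) = a * ip x y.
Proof. by rewrite ipC ipZl ipC. Qed.

Lemma ipNl x y : ip (- x) y = - ip x y.
Proof. by rewrite -scaleN1r ipZl mulN1r. Qed.

Lemma ipNr x y : ip x (- y) = - ip x y.
Proof. by rewrite ipC ipNl ipC. Qed.

Lemma ip0l x : ip 0 x = 0.
Proof. by rewrite -(scale0r 0) ipZl mul0r. Qed.

Lemma ip0r x : ip x 0 = 0.
Proof. by rewrite ipC ip0l. Qed.

Definition ipE := (ipDl, ipDr, ipNl, ipNr, ipZl, ipZr).

Lemma ip_nondegenerate x : (forall y, ip x y = 0) -> x = 0.
Proof.
move=> x0; apply/rowP => i; rewrite mxE; have := x0 (delta_mx 0 i).
rewrite /ip (bigD1 i) //= big1 => [|j ji]; last first.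
  by rewrite mxE (negbTE ji) andbF mulr0.
rewrite mxE !eqxx mulr1 addr0 => /eqP; rewrite mulf_eq0 /tau => /orP[|/eqP//].
by case: ifP; rewrite ?oppr_eq0 oner_eq0.
Qed.

Lemma Ck_ip (V : normedModType R) (U : set V) j (f g : V -> 'rV[R]_(k + l)) :
  open U -> Ck U j f -> Ck U j g -> Ck U j (fun p => ip (f p) (g p)).
Proof.
move=> oU Cf Cg; apply: Ck_sum => // i.
apply: CkM => //; last exact: Ck_coord.
by apply: CkM => //; [exact: Ck_cst|exact: Ck_coord].
Qed.

Lemma derive_coord (V : normedModType R) n (f : V -> 'rV[R]_n) i p v :
  differentiable f p -> 'D_v (fun s => f s 0 i) p = ('D_v f p) 0 i.
Proof.
apply: (@derive_linear_comp R 'rV[R]_n R (fun s : 'rV[R]_n => s 0 i)).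
- by move=> c s t; rewrite !mxE.
- exact: coord_continuous.
Qed.

Lemma derive_ip (V : normedModType R) (f g : V -> 'rV[R]_(k + l)) p v :
  differentiable f p -> differentiable g p ->
  'D_v (fun s => ip (f s) (g s)) p = ip ('D_v f p) (g p) + ip (f p) ('D_v g p).
Proof.
move=> df dg.
have dc h i : differentiable h p ->
    derivable (fun s => (h s : 'rV[R]_(k + l)) 0 i) p v.
  move=> dh; apply: diff_derivable.
  exact: (differentiable_comp dh (differentiable_coord _ _ _)).
have dt i : derivable (fun s => tau R i * f s 0 i) p v.
  by apply: derivableM; [exact: derivable_cst|exact: dc].
have -> : (fun s => ip (f s) (g s)) =
    \sum_i (fun s => tau R i * f s 0 i * g s 0 i).
  by apply/funext => s; rewrite fct_sumE.
rewrite derive_sum => [|i]; last by apply: derivableM; [exact: dt|exact: dc].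
rewrite -big_split; apply: eq_bigr => i _ /=.
rewrite [LHS](@deriveM _ _ (fun s => tau R i * f s 0 i) (fun s => g s 0 i)) //;
  last exact: dc.
rewrite (@deriveM _ _ (cst (tau R i)) (fun s => f s 0 i)) //; last exact: dc.
by rewrite derive_cst !derive_coord // scaler0 addr0 /GRing.scale /=; ring.
Qed.

End ScalarProduct.

(** * The operator J and its inverse, both self-adjoint for the scalar product *)

Section DiagonalOperator.
Context {R : realType} {k l : nat} (J : 'rV[R]_(k + l)).
Implicit Types (x y z : 'rV[R]_(k + l)) (a : R).

Lemma actJE x i : actJ J x 0 i = x 0 i * J 0 i.
Proof. by rewrite /actJ mul_mx_diag mxE. Qed.

Lemma actJ_linear : linear (actJ J).
Proof. by move=> a x y; rewrite /actJ mulmxDl scalemxAl. Qed.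

Lemma actJ_continuous : continuous (actJ J).
Proof.
have : Ck setT 0 (actJ J); last by move=> + x; apply.
apply: Ck_rV => [|i]; first exact: openT.
suff -> : (fun x => actJ J x 0 i) = (fun x => x 0 i * J 0 i).
  apply: CkM; [exact: openT| |exact: Ck_cst].
  by apply: Ck_coord; [exact: openT|exact: Ck_id].
by apply/funext => x; rewrite actJE.
Qed.

Lemma ip_actJ x y : ip (actJ J x) y = ip x (actJ J y).
Proof. by apply: eq_bigr => i _; rewrite !actJE; ring. Qed.

Lemma alpha_formE p u : alpha_form J p u = ip (actJ J p.2) u.1.
Proof. by apply: eq_bigr => i _; rewrite actJE; ring. Qed.

Hypothesis hJ : forall i, J 0 i != 0.

Lemma unitmx_diag : diag_mx J \in unitmx.
Proof. by rewrite unitmxE det_diag unitfE; apply/prodf_neq0 => i _. Qed.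

Lemma actJinvK x : actJ J (actJinv J x) = x.
Proof. by rewrite /actJ /actJinv mulmxKV // unitmx_diag. Qed.

Lemma actJK x : actJinv J (actJ J x) = x.
Proof. by rewrite /actJ /actJinv mulmxK // unitmx_diag. Qed.

Lemma actJinvE x i : actJinv J x 0 i = x 0 i * (J 0 i)^-1.
(* The entries of the inverse matrix are not computed: they follow from J J^-1 x = x. *)
Proof. by rewrite -[x in RHS]actJinvK actJE mulfK. Qed.

Lemma ip_actJinv x y : ip (actJinv J x) y = ip x (actJinv J y).
Proof. by apply: eq_bigr => i _; rewrite !actJinvE; ring. Qed.

Lemma Ck_actJinv (V : normedModType R) (U : set V) j (f : V -> 'rV[R]_(k + l)) :
  open U -> Ck U j f -> Ck U j (fun p => actJinv J (f p)).
Proof.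
move=> oU Cf; apply: Ck_rV => // i.
have := CkM oU (Ck_coord oU i Cf) (@Ck_cst _ _ R U j (J 0 i)^-1).
by apply: Ck_eq => // x _; rewrite actJinvE.
Qed.

End DiagonalOperator.

Lemma Ck_actJ (R : realType) (k l : nat) (J : 'rV[R]_(k + l))
    (V : normedModType R) (U : set V) j (f : V -> 'rV[R]_(k + l)) :
  open U -> Ck U j f -> Ck U j (fun p => actJ J (f p)).
Proof. exact/Ck_linear/actJ_continuous/actJ_linear. Qed.

(** * Curves on the light-like cone with prescribed velocity *)

Lemma nbhs0_itv (R : realType) (P : R -> Prop) :
  (\forall t \near (0 : R), P t) ->
  exists2 e : R, 0 < e & forall t, t \in `]- e, e[ -> P t.
Proof.
move=> /nbhs_ballP[e /= e0 eP]; exists e => // t.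
by rewrite in_itv /= -ltr_norml => te; apply: eP; rewrite /ball /= sub0r normrN.
Qed.

(* The quadric <x, x> = 0 in the hyperplane <x, c> = <q, c>, parametrized
   rationally: with v = q + t a and w' an isotropic vector of the form w + s q,
   the vector <v, v> w' - 2 <v, w'> v is isotropic, and it is rescaled so as to
   have the right product with c. *)
Lemma isotropic_curve (R : realType) (k l : nat) (q c a w : 'rV[R]_(k + l)) :
  ip q q = 0 -> ip q c != 0 -> ip q w != 0 -> ip q a = 0 -> ip c a = 0 ->
  exists2 e : R, 0 < e & exists gamma : R -> 'rV[R]_(k + l),
    [/\ smooth_on [set` `]- e, e[] gamma, gamma 0 = q, 'D_1 gamma 0 = a &
      forall t, t \in `]- e, e[ ->
        [/\ ip (gamma t) (gamma t) = 0, ip (gamma t) c = ip q c &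
            ip (gamma t) w != 0]].
Proof.
move=> qq qc qw qa ca.
have [w' w'w' qw'] : exists2 w', ip w' w' = 0 & ip q w' = ip q w.
  exists (w - (ip w w / (2 * ip q w)) *: q); rewrite !ipE qq; last by ring.
  by rewrite (ipC w q); field.
pose A := ip a a; pose K := ip w' c; pose v t := q + t *: a.
pose E t := ip q w + t * ip a w'.
(* Here <v, v> = t^2 A and <v, w'> = E, so the isotropic vector is t^2 A w' - 2 E v, and its product
   with c is - D. Multiplying it by - <q, c> / D gives v + t^2 (A / D) z, which is [gamma t]. *)
pose D t := 2 * ip q c * E t - t ^+ 2 * (A * K).
pose z t := K *: v t - ip q c *: w'.
pose h t := a + t *: ((A / D t) *: z t).
pose gamma t := q + t *: h t.
have D0 : D 0 != 0.
  by rewrite /D /E expr0n /= !mul0r subr0 addr0 !mulf_neq0 // pnatr_eq0.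
have Ct (U : set R) j : Ck U j (fun t : R => t) by exact: Ck_id.
have Cc (U : set R) j (b : R) : Ck U j (fun _ : R => b) by exact: Ck_cst.
have Cv (U : set R) j (b : 'rV[R]_(k + l)) : Ck U j (fun _ : R => b).
  exact: Ck_cst.
have CD (U : set R) j : open U -> Ck U j D.
  move=> oU.
  have CE : Ck U j E by apply: CkD => //; exact: CkM.
  have C2 := CkM oU (Cc U j (- (A * K))) (CkM oU (Ct U j) (Ct U j)).
  apply: Ck_eq (CkD oU (CkM oU (Cc U j (2 * ip q c)) CE) C2) => // t _.
  by rewrite /D; ring.
pose U := [set t | D t != 0].
have oU : open U := open_neq0 (CD setT 0%N openT).
have Ch j : Ck U j h.
  apply: CkD => //; apply: CkZ => //; apply: CkZ => //.
    by apply: CkM => //; apply: CkV => //; exact: CD.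
  apply: CkD => //; apply: CkZ => //; apply: CkD => //; exact: CkZ.
have Cg j : Ck U j gamma by apply: CkD => //; exact: CkZ.
have g0 : gamma 0 = q by rewrite /gamma scale0r addr0.
have [e e0 eP] : exists2 e : R, 0 < e & forall t, t \in `]- e, e[ ->
    D t != 0 /\ ip (gamma t) w != 0.
  apply: nbhs0_itv; apply: filterI; first exact: (open_nbhs_nbhs (conj oU D0)).
  have Cgw := Ck_ip oU (Cg 0%N) (Cv _ _ w).
  apply: (Cgw 0 D0 [set s | s != 0]).
  by apply: open_nbhs_nbhs; split; [exact: open_neq|rewrite /= g0].
exists e => //; exists gamma; split=> //.
- by move=> j; apply: Ck_sub (Cg j) => t /eP[].
(* As gamma t = q + t h(t), the velocity at 0 is h 0 = a. *)
- by rewrite derive_addl_scale ?/h ?scale0r ?addr0 //; exact: (Ch 0%N 0 D0).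
move=> t /eP[Dt gw]; split=> //.
  rewrite /gamma /h /z /v !ipE w'w' qw' qq !(ipC w') !(ipC a q) qw' qa -/A.
  move: Dt; rewrite /D /E {gw} => Dt.
  by field.
rewrite /gamma /h /z /v !ipE (ipC a) ca -/K; ring.
Qed.

(** * Derivatives on phase space and the exterior derivative of alpha *)

Section PhaseSpace.
Context {R : realType} {k l : nat} (J : 'rV[R]_(k + l)).
Implicit Types p u : phase_space R (k + l).

Lemma Ck_q (U : set (phase_space R (k + l))) j :
  open U -> Ck U j (fun p : phase_space R (k + l) => p.1).
Proof. by move=> oU; apply: Ck_fst => //; exact: Ck_id. Qed.

Lemma Ck_Q (U : set (phase_space R (k + l))) j :
  open U -> Ck U j (fun p : phase_space R (k + l) => p.2).
Proof. by move=> oU; apply: Ck_snd => //; exact: Ck_id. Qed.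

Lemma derive_fst (V : normedModType R) (f : V -> phase_space R (k + l)) x v :
  differentiable f x -> 'D_v (fun s => (f s).1) x = ('D_v f x).1.
Proof.
apply: (@derive_linear_comp R (phase_space R (k + l)) _ fst) => //.
by move=> s; exact: cvg_fst.
Qed.

Lemma derive_snd (V : normedModType R) (f : V -> phase_space R (k + l)) x v :
  differentiable f x -> 'D_v (fun s => (f s).2) x = ('D_v f x).2.
Proof.
apply: (@derive_linear_comp R (phase_space R (k + l)) _ snd) => //.
by move=> s; exact: cvg_snd.
Qed.

Lemma derive_q p u : 'D_u (fun s : phase_space R (k + l) => s.1) p = u.1.
Proof.
by rewrite (@derive_fst _ id) ?derive_id //; exact: ex_diff.
Qed.

Lemma derive_Q p u : 'D_u (fun s : phase_space R (k + l) => s.2) p = u.2.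
Proof.
by rewrite (@derive_snd _ id) ?derive_id //; exact: ex_diff.
Qed.

Lemma differentiable_q p :
  differentiable (fun s : phase_space R (k + l) => s.1) p.
Proof. exact: (Ck_differentiable (Ck_q 1 openT)). Qed.

Lemma differentiable_Q p :
  differentiable (fun s : phase_space R (k + l) => s.2) p.
Proof. exact: (Ck_differentiable (Ck_Q 1 openT)). Qed.

Lemma Ck_lagrangian U j : open U -> Ck U j (lagrangian J).
Proof.
move=> oU; exact: (Ck_ip oU (Ck_q j oU) (Ck_actJ J oU (Ck_Q j oU))).
Qed.

Lemma derive_lagrangian (V : normedModType R) (f g : V -> 'rV[R]_(k + l)) x v :
  differentiable f x -> differentiable g x ->
  'D_v (fun s => lagrangian J (f s, g s)) x =
    ip ('D_v f x) (actJ J (g x)) + ip (f x) (actJ J ('D_v g x)).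
Proof.
move=> df dg.
have dJ := differentiable_linear (actJ_linear J) (@actJ_continuous _ _ _ J).
rewrite [LHS](@derive_ip _ _ _ _ f (fun s => actJ J (g s))) //.
  by rewrite (derive_linear_comp (actJ_linear J) (@actJ_continuous _ _ _ J)).
exact: (differentiable_comp dg (dJ _)).
Qed.

(** For a fixed vector b, alpha at (q, Q) takes the value L(b.1, Q) on b, so differentiating L with
    its first argument frozen is enough. *)
Lemma ext_deriv_alpha p u v :
  ext_deriv (alpha_form J) p u v = ip (actJ J u.2) v.1 - ip (actJ J v.2) u.1.
Proof.
have D a b : 'D_a (alpha_form J ^~ b) p = ip (actJ J a.2) b.1.
  have -> : alpha_form J ^~ b = (fun s => lagrangian J (b.1, s.2)).
    by apply/funext => s; rewrite alpha_formE /lagrangian ipC.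
  rewrite derive_lagrangian;
    [|exact: differentiable_cst|exact: differentiable_Q].
  by rewrite derive_cst ip0l add0r derive_Q ipC.
by rewrite /ext_deriv !D.
Qed.

Lemma one_form_alpha : one_form (alpha_form J).
Proof.
split=> [p a u v|v j].
  by rewrite !alpha_formE /= ipDr ipZr.
have C : Ck setT j (fun s : phase_space R (k + l) => ip (actJ J s.2) v.1).
  apply: Ck_ip; [exact: openT| |exact: Ck_cst].
  by apply: Ck_actJ; [exact: openT|apply: Ck_Q; exact: openT].
by apply: Ck_eq C => [|s _]; [exact: openT|rewrite alpha_formE].
Qed.

Hypothesis hJ : forall i, J 0 i != 0.
Variable kappa : R.
Hypothesis hkappa : 0 < kappa.
Let M := M_level J kappa.

(** * The level set as a submanifold of codimension 3 *)

Lemma M_levelP p : M p <->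
  [/\ ip p.1 p.1 = 0, ip p.2 p.2 = 0, ip p.1 (actJinv J p.2) != 0 &
      lagrangian J p = kappa \/ lagrangian J p = - kappa].
Proof.
split; first by case=> -[] [] [] ? ? ? ?; split=> //; [left|right].
by move=> [? ? ? [|]] L; [left|right].
Qed.

Lemma M_level_lagrangian_neq0 p : M p -> lagrangian J p != 0.
Proof. by case/M_levelP=> _ _ _ [->|->]; rewrite ?oppr_eq0 gt_eqF. Qed.

Lemma M_level_submanifold : (1 <= k)%N -> (1 <= l)%N ->
  submanifold (2 * (k + l) - 3) M.
Proof.
(* The subtraction in 2n - 3 is truncated; k, l >= 1 gives 2n >= 4, so it is exact. *)
move=> k1 l1; exists 3%N; split; first by lia.
move=> p Mp; have [qq QQ qQ Lp] := iffLR (M_levelP p) Mp.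
have Lp0 := M_level_lagrangian_neq0 Mp.
pose c := lagrangian J p.
pose g (s : phase_space R (k + l)) : 'rV[R]_3 :=
  \row_j [:: ip s.1 s.1; ip s.2 s.2; lagrangian J s - c]`_j.
(* The second condition removes the other sheet L = - c; at [p] itself L + c = 2c is nonzero. *)
pose U := [set s : phase_space R (k + l) | ip s.1 (actJinv J s.2) != 0] `&`
  [set s | lagrangian J s + c != 0].
have oU : open U.
  have oT : open [set: phase_space R (k + l)] := openT.
  apply: openI; apply: open_neq0.
    exact: (Ck_ip oT (Ck_q 0 oT) (Ck_actJinv hJ oT (Ck_Q 0 oT))).
  exact: (CkD oT (Ck_lagrangian 0 oT) (@Ck_cst _ _ R _ 0 c)).
have Cg j : Ck U j g.
  apply: Ck_rV => // -[[|[|[|//]]] i3].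
  - apply: (Ck_eq oU (f := fun s => ip s.1 s.1)) => [s _|].
      by rewrite mxE.
    exact: (Ck_ip oU (Ck_q j oU) (Ck_q j oU)).
  - apply: (Ck_eq oU (f := fun s => ip s.2 s.2)) => [s _|].
      by rewrite mxE.
    exact: (Ck_ip oU (Ck_Q j oU) (Ck_Q j oU)).
  - apply: (Ck_eq oU (f := fun s => lagrangian J s - c)) => [s _|].
      by rewrite mxE.
    exact: (CkD oU (Ck_lagrangian j oU) (@Ck_cst _ _ R _ j (- c))).
have gE s : U s -> (M s <-> g s = 0).
  move=> [sQ sL]; split.
    move=> /M_levelP[sqq sQQ _ Ls]; apply/rowP.
    move=> -[[|[|[|//]]] i3]; rewrite !mxE //=.
    move: sL; rewrite /= /c.
    by case: Lp Ls => -> [] ->; rewrite ?subrr ?addNr ?eqxx //.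
  move=> gs; apply/M_levelP; split=> //.
  - by have /rowP/(_ (inord 0)) := gs; rewrite !mxE inordK.
  - by have /rowP/(_ (inord 1)) := gs; rewrite !mxE inordK.
  - have /rowP/(_ (inord 2)) := gs; rewrite !mxE inordK //= => /eqP.
    by rewrite subr_eq0 => /eqP ->.
exists U, g; split=> //.
  split=> //; rewrite /= /c -mulr2n mulrn_eq0 //.
move=> s Us gs y; have /M_levelP[sqq sQQ _ _] := iffRL (gE s Us) gs.
have [sB _] := Us.
have sL : lagrangian J s != 0 by apply/M_level_lagrangian_neq0/gE.
pose B := ip s.1 (actJinv J s.2); have B0 : B != 0 := sB.
(* The three directions (J^-1 Q, 0), (0, J^-1 q) and (q, 0) diagonalize the differential of [g],
   with entries 2B, 2B and L; the off-diagonal terms are <q, q>, <Q, Q> or 0. *)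
pose w : phase_space R (k + l) :=
  ((y 0 (inord 0) / (2 * B)) *: actJinv J s.2
     + (y 0 (inord 2) / lagrangian J s) *: s.1,
   (y 0 (inord 1) / (2 * B)) *: actJinv J s.1).
exists w; rewrite -deriveE; last exact: (Ck_differentiable (Cg 1%N)).
apply/rowP => i.
rewrite -derive_coord; last exact: (Ck_differentiable (Cg 1%N)).
have sB' : ip s.2 (actJinv J s.1) = B by rewrite ipC ip_actJinv.
have dq := differentiable_q s; have dQ := differentiable_Q s.
case: i => -[|[|[|//]]] i3.
- have -> : (fun t => g t 0 (Ordinal i3)) = (fun t => ip t.1 t.1).
    by apply/funext => t; rewrite mxE.
  rewrite derive_ip // derive_q /w /= !ipE sqq (ipC _ s.1) -/B.
  have -> : Ordinal i3 = inord 0 by apply/val_inj; rewrite /= inordK.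
  by field; rewrite ?sL ?B0.
- have -> : (fun t => g t 0 (Ordinal i3)) = (fun t => ip t.2 t.2).
    by apply/funext => t; rewrite mxE.
  rewrite derive_ip // derive_Q /w /= !ipE (ipC _ s.2) sB'.
  have -> : Ordinal i3 = inord 1 by apply/val_inj; rewrite /= inordK.
  by field; rewrite ?sL ?B0.
- have -> : (fun t => g t 0 (Ordinal i3)) =
      (fun t => lagrangian J (t.1, t.2)) + cst (- c).
    by apply/funext => t; rewrite mxE.
  rewrite deriveD; [|apply: diff_derivable|exact: derivable_cst]; last first.
    exact: (Ck_differentiable (Ck_lagrangian 1 openT)).
  rewrite derive_cst addr0 derive_lagrangian // derive_q derive_Q /w /= !ipE.
  rewrite -!ip_actJ actJinvK // !ipE !ip_actJ actJinvK // sqq sQQ.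
  rewrite -/(lagrangian J s).
  have -> : Ordinal i3 = inord 2 by apply/val_inj; rewrite /= inordK.
  by field; rewrite ?sL ?B0.
Qed.

(** * Tangent vectors: the linear equations they satisfy, and enough curves realizing them *)

Lemma tangent_space_eqs p u : tangent_space M p u ->
  [/\ ip p.1 u.1 = 0, ip p.2 u.2 = 0 &
      ip (actJ J p.2) u.1 + ip (actJ J p.1) u.2 = 0].
Proof.
move=> [e [e0 [gam [Cg Mg g0 g0']]]].
have dg : differentiable gam 0.
  apply: (Ck_differentiable (Cg 1%N)).
  by rewrite /= in_itv /= oppr_lt0 e0.
have d1 : differentiable (fun t => (gam t).1) 0.
  exact: (differentiable_comp dg (differentiable_q _)).
have d2 : differentiable (fun t => (gam t).2) 0.
  exact: (differentiable_comp dg (differentiable_Q _)).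
have D1 : 'D_1 (fun t => (gam t).1) 0 = u.1.
  by rewrite -g0'; exact: derive_fst.
have D2 : 'D_1 (fun t => (gam t).2) 0 = u.2.
  by rewrite -g0'; exact: derive_snd.
have near_cst (F : R -> R) c :
    (forall t, t \in `]- e, e[ -> F t = c) -> 'D_1 F 0 = 0.
  move=> Fc; rewrite (@near_eq_derive _ _ _ _ (cst c)) ?derive_cst //.
  near=> t; apply: Fc; near: t; apply: near_in_itvoo.
  by rewrite in_itv /= oppr_lt0 e0.
have half (x : R) : x + x = 0 -> x = 0.
  by move=> /eqP; rewrite -mulr2n mulrn_eq0 /= => /eqP.
split.
- apply: half; rewrite -(near_cst (fun t => ip (gam t).1 (gam t).1) 0).
    by rewrite derive_ip // D1 g0 (ipC u.1).
  by move=> t /Mg/M_levelP[].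
- apply: half; rewrite -(near_cst (fun t => ip (gam t).2 (gam t).2) 0).
    by rewrite derive_ip // D2 g0 (ipC u.2).
  by move=> t /Mg/M_levelP[].
- pose F t := lagrangian J ((gam t).1, (gam t).2).
  have DF : 'D_1 F 0 = ip (actJ J p.2) u.1 + ip (actJ J p.1) u.2.
    by rewrite derive_lagrangian // D1 D2 g0 (ipC u.1) !ip_actJ.
  have F0 : F 0 = lagrangian J p by rewrite /F g0.
  have dF : derivable F 0 1.
    apply: diff_derivable.
    have CL := Ck_lagrangian 1 openT.
    exact: (differentiable_comp dg (Ck_differentiable CL _)).
  (* L takes the two values kappa and - kappa on [M], but its square is constant along the curve;
     the derivative 2 L L' = 0 gives L' = 0 since L is nonzero. *)
  have FF : forall t, t \in `]- e, e[ -> F t * F t = kappa * kappa.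
    move=> t /Mg/M_levelP[_ _ _]; rewrite -[lagrangian J _]/(F t).
    by case=> ->; rewrite ?mulrNN.
  have := near_cst _ _ FF.
  rewrite [X in X = _](deriveM dF dF) DF F0 => /half/eqP.
  have Mp : M p by rewrite -g0; apply: Mg; rewrite in_itv /= oppr_lt0 e0.
  rewrite mulf_eq0 (negbTE (M_level_lagrangian_neq0 Mp)) => /eqP //.
Unshelve. all: by end_near. Qed.

(** Q stays fixed and q moves along [isotropic_curve] with c = J Q and w = J^-1 Q: this keeps q
    isotropic, L constant and <q, J^-1 Q> nonzero. *)
Lemma tangent_space_q p a : M p -> ip p.1 a = 0 -> ip (actJ J p.2) a = 0 ->
  tangent_space M p (a, 0).
Proof.
move=> Mp qa Qa; have [qq QQ qQ Lp] := iffLR (M_levelP p) Mp.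
have [e e0 [gam [Cg g0 g0' gP]]] :=
  isotropic_curve qq (M_level_lagrangian_neq0 Mp) qQ qa Qa.
have oI : open [set` `]- e, e[] by exact: interval_open.
exists e; split=> //; exists (fun t => (gam t, p.2)); split.
- by move=> j; exact: (Ck_pair oI (Cg j) (Ck_cst _ j p.2)).
- move=> t /gP[gg gL gQ]; apply/M_levelP; split=> //=.
  by rewrite /lagrangian /= gL.
- by rewrite g0; case: (p).
- rewrite derive_pair; [by rewrite g0' derive_cst| |exact: differentiable_cst].
  by apply: (Ck_differentiable (Cg 1%N)); rewrite /= in_itv /= oppr_lt0 e0.
Qed.

(** J and J^-1 are self-adjoint, so the defining conditions are symmetric in q and Q. This symmetry
    transfers every result on q-directions to Q-directions. *)
Lemma M_level_swap p : M p -> M (p.2, p.1).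
Proof.
move=> /M_levelP[qq QQ qQ Lp]; apply/M_levelP; split=> //=.
  by rewrite -ip_actJinv // ipC.
by rewrite /lagrangian /= -ip_actJ ipC.
Qed.

Lemma tangent_space_swap p u :
  tangent_space M p u -> tangent_space M (p.2, p.1) (u.2, u.1).
Proof.
move=> [e [e0 [gam [Cg Mg g0 g0']]]].
have oI : open [set` `]- e, e[] by exact: interval_open.
have C1 j : Ck [set` `]- e, e[] j (fun t => (gam t).1) by exact: Ck_fst.
have C2 j : Ck [set` `]- e, e[] j (fun t => (gam t).2) by exact: Ck_snd.
have I0 : [set` `]- e, e[] (0 : R) by rewrite /= in_itv /= oppr_lt0 e0.
have dg := Ck_differentiable (Cg 1%N) I0.
have d1 := Ck_differentiable (C1 1%N) I0.
have d2 := Ck_differentiable (C2 1%N) I0.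
exists e; split=> //; exists (fun t => ((gam t).2, (gam t).1)); split.
- by move=> j; exact: (Ck_pair oI (C2 j) (C1 j)).
- by move=> t /Mg/M_level_swap.
- by rewrite g0.
- rewrite derive_pair //; congr pair; rewrite -g0'.
    exact: derive_snd.
  exact: derive_fst.
Qed.

Lemma tangent_space_Q p b : M p -> ip p.2 b = 0 -> ip (actJ J p.1) b = 0 ->
  tangent_space M p (0, b).
Proof.
move=> /M_level_swap Mp Qb qb.
have := tangent_space_swap (tangent_space_q Mp Qb qb).
by case: (p).
Qed.

(* Velocity of the curve ((1 + t) q, (1 + t)^-1 Q). *)
Lemma tangent_space_scaling p : M p ->
  exists2 u, tangent_space M p u & u.1 = p.1.
Proof.
move=> Mp; have [qq QQ qQ Lp] := iffLR (M_levelP p) Mp.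
have oI : open [set` `]- (1 : R), 1[] by exact: interval_open.
have I0 : [set` `]- (1 : R), 1[] (0 : R) by rewrite /= in_itv /= oppr_lt0 ltr01.
have t0 t : [set` `]- (1 : R), 1[] t -> 1 + t != 0.
  by rewrite /= in_itv /= => /andP[t1 _]; rewrite gt_eqF // -ltrBlDl sub0r.
have C0 j : Ck [set` `]- (1 : R), 1[] j (fun t : R => 1 + t).
  exact: (CkD oI (@Ck_cst _ _ R _ j 1) (Ck_id _ j)).
have C1 j : Ck [set` `]- (1 : R), 1[] j (fun t : R => (1 + t) *: p.1).
  exact: (CkZ oI (C0 j) (Ck_cst _ j p.1)).
have C2 j : Ck [set` `]- (1 : R), 1[] j (fun t : R => (1 + t)^-1 *: p.2).
  exact: (CkZ oI (CkV oI t0 (C0 j)) (Ck_cst _ j p.2)).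
pose gam t : phase_space R (k + l) := ((1 + t) *: p.1, (1 + t)^-1 *: p.2).
exists ('D_1 gam 0).
  exists 1; split; first exact: ltr01.
  exists gam; split=> //.
  - by move=> j; exact: (Ck_pair oI (C1 j) (C2 j)).
  - move=> t /t0 tn0; apply/M_levelP; rewrite /lagrangian /gam /=; split.
    + by rewrite !ipE qq !mulr0.
    + by rewrite !ipE QQ !mulr0.
    + by rewrite -ip_actJinv // ipZr ip_actJinv // ipZl mulKf.
    + by rewrite -ip_actJ ipZr ip_actJ ipZl mulKf.
  - by rewrite /gam addr0 invr1 !scale1r; case: (p).
(* Only the q-component of the velocity is computed, since alpha involves only dq. *)
rewrite [X in X.1]derive_pair; last 2 first.
- exact: (Ck_differentiable (C1 1%N)).
- exact: (Ck_differentiable (C2 1%N)).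
have -> : (fun t : R => (1 + t) *: p.1) = (fun t : R => p.1 + t *: cst p.1 t).
  by apply/funext => t; rewrite scalerDl scale1r.
have C : {for (0 : R), continuous (cst p.1 : R -> 'rV[R]_(k + l))}.
  exact: cst_continuous.
exact: (derive_addl_scale p.1 C).
Qed.

(** * Nondegeneracy of d alpha on the kernel of alpha *)

(* J^-1 Q and q span a complement of the orthogonal of q and J Q, and <J b, .>
   vanishes on both of them. *)
Lemma orthogonal_complement_eq0 p b :
  M p -> ip p.2 b = 0 -> ip (actJ J p.1) b = 0 ->
  (forall a, ip p.1 a = 0 -> ip (actJ J p.2) a = 0 -> ip (actJ J b) a = 0) ->
  b = 0.
Proof.
move=> Mp Qb qb ba; have [qq QQ qQ _] := iffLR (M_levelP p) Mp.
have L0 := M_level_lagrangian_neq0 Mp.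
suff Jb0 : actJ J b = 0.
  by rewrite -(actJK hJ b) Jb0 /actJinv mul0mx.
apply: ip_nondegenerate => x.
pose B := ip p.1 (actJinv J p.2); pose L := lagrangian J p.
(* Projection of x along q and J^-1 Q. Since <q, q> = <J Q, J^-1 Q> = 0, each coefficient is fixed
   by a single equation, with divisors L = <J Q, q> and B = <q, J^-1 Q>. *)
pose a :=
  x - (ip (actJ J p.2) x / L) *: p.1 - (ip p.1 x / B) *: actJinv J p.2.
have Lq : ip (actJ J p.2) p.1 = L by rewrite ipC.
have JQw : ip (actJ J p.2) (actJinv J p.2) = 0 by rewrite ip_actJ actJinvK.
have B0 : B != 0 := qQ; have {}L0 : L != 0 := L0.
have qa : ip p.1 a = 0.
  by rewrite /a !ipE qq -/B; field; rewrite ?B0 ?L0.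
have Qa : ip (actJ J p.2) a = 0.
  by rewrite /a !ipE JQw Lq; field; rewrite ?B0 ?L0.
have -> : x =
    a + (ip p.1 x / B) *: actJinv J p.2 + (ip (actJ J p.2) x / L) *: p.1.
  by rewrite /a !subrK.
rewrite 2!ipDr ba // !ipZr !(ip_actJ J b) actJinvK // (ipC b p.2) Qb (ipC b) qb.
by rewrite !mulr0 !addr0.
Qed.

(** For a tangent u in the kernel of alpha, the equation dL = 0 also gives <J q, u.2> = 0. Hence
    both components of u satisfy the orthogonality conditions of [orthogonal_complement_eq0], and
    pairing with (0, b) and (a, 0) separately kills them. *)
Lemma contact_form_alpha : (1 <= k)%N -> (1 <= l)%N ->
  contact_form (2 * (k + l) - 3) M (alpha_form J).
Proof.
move=> k1 l1; split.
- exact: M_level_submanifold.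
- by lia.
- exact: one_form_alpha.
- move=> p Mp; have [u Tu u1] := tangent_space_scaling Mp; exists u => //.
  by rewrite alpha_formE u1 ipC; exact: M_level_lagrangian_neq0.
move=> p Mp u Tu; rewrite alpha_formE => au du.
have [qu Qu] := tangent_space_eqs Tu; rewrite au add0r => Ju.
suff [u1 u2] : u.1 = 0 /\ u.2 = 0.
  by case: u u1 u2 {Tu au du qu Qu Ju} => /= ? ? -> ->.
split.
  (* For [u.1] the roles of q and Q are exchanged, so the complement lemma is used at the swapped
     point. *)
  apply: (orthogonal_complement_eq0 (M_level_swap Mp)) => //= b Qb qb.
  have := du _ (tangent_space_Q Mp Qb qb).
  rewrite alpha_formE ext_deriv_alpha /= !ip0r sub0r => /(_ erefl)/eqP.
  by rewrite oppr_eq0 => /eqP; rewrite ip_actJ ipC.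
apply: (orthogonal_complement_eq0 Mp) => // a qa Qa.
have := du _ (tangent_space_q Mp qa Qa); rewrite alpha_formE ext_deriv_alpha /=.
by move=> /(_ Qa); rewrite /actJ mul0mx ip0l subr0.
Qed.

(** * The Heisenberg map: smoothness, inverse, invariance of the level set and of alpha *)

Lemma open_heis_domain : open (heis_domain J).
Proof.
have oT : open [set: phase_space R (k + l)] := openT.
have CQ := Ck_Q 0 oT.
exact: (open_neq0 (Ck_ip oT (Ck_actJinv hJ oT (Ck_actJinv hJ oT CQ)) CQ)).
Qed.

(** The inner map [f] is arbitrary so that the same lemma covers the Heisenberg map and its
    composition with the swap. *)
Lemma Ck_heisenberg (V : normedModType R) (U : set V) j
    (f : V -> phase_space R (k + l)) :
  open U -> (forall x, U x -> heis_domain J (f x)) -> Ck U j f ->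
  Ck U j (fun x => heisenberg J (f x)).
Proof.
move=> oU Uf Cf; have Cq := Ck_fst oU Cf; have CQ := Ck_snd oU Cf.
have CJ := Ck_actJinv hJ oU CQ.
have CN := CkM oU (@Ck_cst _ _ R U j 2) (Ck_ip oU CJ Cq).
have CI := CkV oU Uf (Ck_ip oU (Ck_actJinv hJ oU CJ) CQ).
have CB := CkD oU (CkZ oU (CkM oU CN CI) CJ)
  (CkZ oU (@Ck_cst _ _ R U j (-1)) Cq).
by apply: (Ck_eq oU _ (Ck_pair oU CQ CB)) => x _; rewrite /= scaleN1r.
Qed.

(* The inverse of the Heisenberg map is its conjugate by the swap of q and Q. *)
Lemma heisenberg_swapK p : heis_domain J p ->
  let p' := heisenberg J p in
  heisenberg J (p'.2, p'.1) = (p.2, p.1).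
Proof.
rewrite /heis_domain /heisenberg /= => D0; congr pair.
(* The factor at the swapped image is again lambda: writing N = J^-1 Q, one has 2 <N, lambda N - q>
   / <N, N> = 2 lambda - lambda. *)
rewrite [X in X *: _](_ : _ = heis_lambda J p).
  by rewrite opprB addrC subrK.
rewrite /heis_lambda /= !ipE (ip_actJinv hJ (actJinv J p.2)) in D0 *.
by field.
Qed.

(** The lambda term contributes lambda <Q, J J^-1 Q> = lambda <Q, Q> = 0, which leaves - <Q, J
    q>. *)
Lemma lagrangian_heisenberg p : ip p.2 p.2 = 0 ->
  lagrangian J (heisenberg J p) = - lagrangian J p.
Proof.
move=> QQ; rewrite /lagrangian /heisenberg /= -ip_actJ.
rewrite !ipE ip_actJ actJinvK // QQ.
by rewrite mulr0 add0r ipC.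
Qed.

(** With N = J^-1 Q, the vector lambda N - q is minus the reflection of q in the hyperplane
    orthogonal to N. It is therefore isotropic with q, and its product with N is again <N, q>. *)
Lemma P0star_heisenberg p : heis_domain J p -> P0star J p ->
  P0star J (heisenberg J p).
Proof.
rewrite /heis_domain /P0star /P0 /light_cone /heisenberg /heis_lambda /=.
rewrite (ip_actJinv hJ (actJinv J p.2)) => D0 [[qq QQ] qQ].
split; first split=> //.
  by rewrite !ipE qq (ipC p.1); field.
rewrite -ip_actJinv // !ipE (ipC _ p.1) divfK //.
by rewrite mulr_natl mulr2n addrK.
Qed.

Lemma M_plus_minus_heisenberg p : heis_domain J p ->
  (M_plus J kappa p -> M_minus J kappa (heisenberg J p)) /\
  (M_minus J kappa p -> M_plus J kappa (heisenberg J p)).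
Proof.
by move=> Dp; split=> -[Pp Lp]; (split; first exact: P0star_heisenberg);
  rewrite lagrangian_heisenberg ?Lp ?opprK //; case: Pp => -[].
Qed.

Lemma M_level_heisenberg p : heis_domain J p -> M p -> M (heisenberg J p).
Proof. by move=> /M_plus_minus_heisenberg[pm mp] [/pm|/mp]; [right|left]. Qed.

Lemma partial_diffeo_heisenberg :
  partial_diffeo M (heis_domain J) (heisenberg J).
Proof.
have oT : open [set: phase_space R (k + l)] := openT.
split; [exact: open_heis_domain| |].
  move=> j; exact: (Ck_heisenberg open_heis_domain _ (Ck_id _ j)).
pose sw (p : phase_space R (k + l)) : phase_space R (k + l) := (p.2, p.1).
have swK p : sw (sw p) = p by case: p.
have csw : continuous sw.
  by move=> s; exact: (Ck_pair oT (Ck_Q 0 oT) (Ck_q 0 oT) s I).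
have oV : open (sw @^-1` heis_domain J).
  apply: (open_comp (f := sw)) => [s _|]; first exact: csw.
  exact: open_heis_domain.
(* The inverse is the Heisenberg map conjugated by the swap, on the swapped domain. *)
exists (sw @^-1` heis_domain J), (fun p => sw (heisenberg J (sw p))).
split=> //.
- move=> j.
  have C : Ck (sw @^-1` heis_domain J) j (fun s => heisenberg J (sw s)).
    exact: (Ck_heisenberg oV _ (Ck_pair oV (Ck_Q j oV) (Ck_q j oV))).
  exact: (Ck_pair oV (Ck_snd oV C) (Ck_fst oV C)).
(* The swapped image has Q as second component again, so its domain condition is [Dp] by
   computation. *)
- move=> p Mp Dp; split; [exact: M_level_heisenberg|by []|].
  by rewrite /sw heisenberg_swapK //=; case: (p).
- move=> p /M_level_swap Mp Dp; split.
  + exact/M_level_swap/M_level_heisenberg.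
  + by [].
  + have := heisenberg_swapK Dp; rewrite -/(sw p) -/(sw (heisenberg _ _)) => ->.
    by case: (p).
Qed.

(** Alpha sees only the first component of the differential of the map, which is dQ, so lambda is
    never differentiated. The term lambda <Q, dQ> vanishes on tangent vectors. *)
Lemma pullback_heisenberg p : M p -> heis_domain J p ->
  forall u, tangent_space M p u ->
    pullback (heisenberg J) (alpha_form J) p u = alpha_form J p u.
Proof.
move=> Mp Dp u /tangent_space_eqs[_ Qu Lu].
have dF : differentiable (heisenberg J) p.
  exact: (Ck_differentiable (Ck_heisenberg open_heis_domain _ (Ck_id _ 1)) Dp).
have dF1 : ('d (heisenberg J) p u).1 = u.2.
  by rewrite -deriveE // -(derive_fst u dF); exact: derive_Q.
rewrite /pullback !alpha_formE dF1 /= ip_actJ !ipE -ip_actJ.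
rewrite ip_actJ ip_actJinv // actJK // Qu mulr0 add0r.
by apply/eqP; rewrite eq_sym -addr_eq0 -ip_actJ; apply/eqP.
Qed.

End PhaseSpace.

Theorem theorem2p1 (R : realType) (k l : nat) (hk : (1 <= k)%N)
    (hl : (1 <= l)%N) (J : 'rV[R]_(k + l)) (hJ : forall i, J 0 i != 0)
    (kappa : R) (hkappa : 0 < kappa) :
  [/\ contact_form (2 * (k + l) - 3) (M_level J kappa) (alpha_form J),
      partial_diffeo (M_level J kappa) (heis_domain J) (heisenberg J),
      (forall p, M_level J kappa p -> heis_domain J p ->
        forall u, tangent_space (M_level J kappa) p u ->
          pullback (heisenberg J) (alpha_form J) p u = alpha_form J p u) &
      (forall p, heis_domain J p ->
        (M_plus J kappa p -> M_minus J kappa (heisenberg J p)) /\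
        (M_minus J kappa p -> M_plus J kappa (heisenberg J p)))].
Proof.
split.
- exact: contact_form_alpha.
- exact: partial_diffeo_heisenberg.
- exact: pullback_heisenberg.
- by move=> p; exact: M_plus_minus_heisenberg.
Qed.
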